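(* Let $m$ be a positive integer and $\mathbf{x}=(x_1,\dots,x_k)$. Then $$\sum_{\lambda=(\alpha+2m|\alpha)}(-1)^{\frac{|\lambda|+\operatorname{rk}\lambda}{2}+m\operatorname{rk}\lambda} s_\lambda(\mathbf{x})=\prod^k_{i=1}(1-x_i)\prod_{1 \leq i< j \leq k}(1-x_ix_j)\,\det\left(f_{s-t}(\mathbf{x})+f_{s+t-1}(\mathbf{x})\right)_{1\leq s,t\leq m},$$ $$\sum_{\lambda=(\alpha+2m+1|\alpha)}(-1)^{\frac{|\lambda|}{2}+m\operatorname{rk}\lambda} s_\lambda(\mathbf{x})=\prod_{1 \leq i\leq j \leq k}(1-x_ix_j)\,\det\left(f_{s-t}(\mathbf{x})-f_{s+t}(\mathbf{x})\right)_{1\leq s,t\leq m},$$ $$\sum_{\lambda=(\alpha+2m-1|\alpha)}(-1)^{\frac{|\lambda|}{2}+m\operatorname{rk}\lambda} s_\lambda(\mathbf{x})=\frac{1}{2}\prod_{1 \leq i< j \leq k}(1-x_ix_j)\,\det\left(f_{s-t}(\mathbf{x})+f_{s+t-2}(\mathbf{x})\right)_{1\leq s,t\leq m},$$ where each sum runs over all partitions $\lambda$ of the indicated form.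
   Context: Frobenius notation: for a partition $\lambda$ with conjugate $\lambda'$, the rank $r=\operatorname{rk}\lambda$ is the largest integer with $\lambda_r\ge r$ ($0$ for the empty partition), and $\lambda=(\alpha_1,\dots,\alpha_r|\beta_1,\dots,\beta_r)$ with $\alpha_i=\lambda_i-i$, $\beta_i=\lambda'_i-i$, both strictly decreasing sequences of nonnegative integers. For an integer $c\ge 0$, $\lambda=(\alpha+c|\alpha)$ means $\lambda=(\alpha_1+c,\dots,\alpha_r+c|\alpha_1,\dots,\alpha_r)$ for some strictly decreasing sequence $\alpha_1>\dots>\alpha_r\ge 0$ (possibly empty, giving the empty partition). $|\lambda|$ is the sum of the parts. $s_\lambda(\mathbf{x})$ is the Schur polynomial in $x_1,\dots,x_k$, which is $0$ when $\lambda$ has more than $k$ parts (so all sums are finite). For $i\ge 0$, $$f_i(\mathbf{x})=f_{-i}(\mathbf{x})=\sum^{k-i}_{j=0}e_j(\mathbf{x})e_{i+j}(\mathbf{x}),$$ with $e_j$ the elementary symmetric polynomials; the sum is empty (zero) if $i>k$. *)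

(* Defs.v *)
From mathcomp Require Import all_boot all_order all_algebra.
From mathcomp Require Import boolp classical_sets fsbigop.
From mathcomp Require Import mpoly.

Set Implicit Arguments.
Unset Strict Implicit.
Unset Printing Implicit Defensive.

Import GRing.Theory.
Local Open Scope ring_scope.

(** Partitions: the parts l = [:: l_1; l_2; ...] are stored from index 0, so
    that l_i is [part l i] for i >= 1, and 0 when i > size l. *)

Definition is_partition (l : seq nat) : bool :=
  sorted geq l && all (leq 1) l.

Definition part (l : seq nat) (i : nat) : nat := nth 0%N l i.-1.

Definition conj_part (l : seq nat) (i : nat) : nat := count (leq i) l.

Definition rk (l : seq nat) : nat :=
  \max_(r < (size l).+1 | (0 < r)%N && (r <= part l r)%N) r.

(** Frobenius coordinates; the truncated subtractions are exact since
    l_i >= i and l'_i >= i for 1 <= i <= rk l. *)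
Definition arms (l : seq nat) : seq nat :=
  [seq (part l i - i)%N | i <- iota 1 (rk l)].

Definition legs (l : seq nat) : seq nat :=
  [seq (conj_part l i - i)%N | i <- iota 1 (rk l)].

(** The partitions l = (a + c | a). *)
Definition frobenius_shift (c : nat) : set (seq nat) :=
  fun l => is_partition l /\
    exists a : seq nat,
      [/\ sorted gtn a, arms l = [seq (b + c)%N | b <- a] & legs l = a].

(** det (x_j ^ (l_i + k - i)), where the index i of l_i is i.+1 in the code. *)
Definition alternant (k : nat) (l : seq nat) : {mpoly rat[k]} :=
  \det (\matrix_(i < k, j < k) 'X_j ^+ (part l i.+1 + (k - i.+1))%N).

(** The Schur polynomial as the quotient of two alternants, the denominator
    being the (nonzero) Vandermonde determinant; the quotient is formed in
    Q(x_1, ..., x_k). *)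
Definition schur (k : nat) (l : seq nat) : {fraction {mpoly rat[k]}} :=
  if (size l <= k)%N then tofrac (alternant k l) / tofrac (alternant k [::])
  else 0.

(** The number of terms is k - |i| + 1, truncated to 0 when |i| > k. *)
Definition f (k : nat) (i : int) : {mpoly rat[k]} :=
  \sum_(j < k.+1 - `|i|%N) mesym k rat j * mesym k rat (`|i| + j)%N.

(* Main.v *)
(** Multiplied by the Vandermonde determinant, the signed sum over the partitions
    (a + c | a) is the expansion along rows of
    det (x_j^(k-1-i) + eta x_j^(k+i+c)): in Frobenius coordinates the exponents of
    the alternant of (a + c | a) are those of the staircase with k-1-a_i replaced
    by k+c+a_i. With c = 2m + d - 1 this is, up to powers of x_j, the evaluation at
    the x_j of k consecutive Chebyshev-like functions
    b_p = x^-p + eta x^(p+d), p = m, ..., m+k-1. Since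
    G(z) = prod_j (1 + x_j z)(1 + x_j / z) = sum_i f_i z^i vanishes at -x_j and
    -1/x_j, the products G b_n (n < m), folded by the symmetry of b_p, give m linear
    relations among b_0, ..., b_(m+k-1) whose coefficients are
    f_(p-n) +- f_(p+n+d), up to signs (-1)^(p+n). Complementary minors then reduce the determinant to the
    m x m Toeplitz-plus-Hankel one times det (b_i(x_j)) for i < k, and the latter is
    a Vandermonde determinant in x + 1/x. *)

Require Import Defs.
From mathcomp Require Import all_boot all_order all_algebra all_fingroup.
From mathcomp Require Import zify ring.
From mathcomp Require Import boolp classical_sets fsbigop.
From mathcomp Require Import mpoly.

Set Implicit Arguments.
Unset Strict Implicit.
Unset Printing Implicit Defensive.

Import GRing.Theory.

(** * Partitions and Frobenius coordinates *)

Lemma leq_rk (l : seq nat) r : 0 < r -> r <= part l r -> r <= rk l.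
Proof.
move=> r_gt0 le_r; have lt_r : r < (size l).+1.
  rewrite ltnS; apply: contraTT le_r; rewrite -!ltnNge => lt_r.
  by rewrite /part nth_default //; lia.
by apply: (@leq_bigmax_cond _ _ _ (Ordinal lt_r)); rewrite /= r_gt0.
Qed.

Lemma rk_leq_part (l : seq nat) : rk l <= part l (rk l).
Proof.
rewrite /rk; apply: (big_ind (fun r => r <= part l r)) => //.
- by move=> r s; have [] := leqP r s.
- by move=> r /andP[].
Qed.

Lemma rk_eq (l : seq nat) n : n <= part l n ->
  (forall r, 0 < r -> r <= part l r -> r <= n) -> rk l = n.
Proof.
move=> le_n n_max; apply/eqP; rewrite eqn_leq; apply/andP; split.
  by case: (posnP (rk l)) => [-> //|/n_max]; apply; apply: rk_leq_part.
by case: n le_n {n_max} => // n; apply: leq_rk.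
Qed.

(* The rows left when the outer hook of the partition [h :: t] is deleted. *)
Definition strip_hook (t : seq nat) : seq nat :=
  [seq i.-1 | i <- t & 1 < i].

Lemma all_geq_sorted h t : path geq h t = all (geq h) t && sorted geq t.
Proof. by rewrite path_sortedE // => x y z /=; lia. Qed.

(** In a decreasing list the entries at most 1 form a suffix, so filtering only truncates; past the
    cut both sides are 0, by the default value on the left. *)
Lemma nth_strip_hook t i :
  sorted geq t -> nth 0 (strip_hook t) i = (nth 0 t i).-1.
Proof.
rewrite /strip_hook; elim: t i => [|x t IHt] i; first by rewrite !nth_nil.
rewrite /= all_geq_sorted => /andP[le_x sorted_t].
case: ltnP => x1; first by case: i => //= i; apply: IHt.
rewrite (eq_in_filter (a2 := pred0)) ?filter_pred0 ?nth_nil; last first.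
  by move=> y /(allP le_x) /=; lia.
case: i => [|i] /=; first by lia.
case: (ltnP i (size t)) => lt_i; last by rewrite nth_default.
by have /(allP le_x) /= := mem_nth 0 lt_i; lia.
Qed.

(** The parts equal to 1 lost by stripping return as the padding zeros, which the increment turns
    back into ones. *)
Lemma strip_hookK t : is_partition t ->
  [seq i.+1 | i <- strip_hook t ++ nseq (size t - size (strip_hook t)) 0] = t.
Proof.
rewrite /is_partition /strip_hook.
elim: t => //= x t IHt; rewrite all_geq_sorted => /and3P[/andP[le_x st] x0 at1].
case: ltnP => x1 /=; first by rewrite subSS IHt ?st ?prednK //; lia.
rewrite (eq_in_filter (a2 := pred0)) ?filter_pred0 /=; last first.
  by move=> y /(allP le_x) /=; lia.
have -> : x = 1 by lia.
rewrite map_nseq; congr cons; apply/esym/all_pred1P/allP => y yt.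
by move: (allP le_x _ yt) (allP at1 _ yt) => /=; lia.
Qed.

Lemma strip_hookP t : is_partition t -> is_partition (strip_hook t).
Proof.
rewrite /is_partition /strip_hook => /andP[st at1]; apply/andP; split.
  rewrite sorted_map; apply: (sub_sorted (e := geq)); first by move=> x y /=; lia.
  by apply: sorted_filter => // x y z /=; lia.
by rewrite all_map; apply/allP => y; rewrite mem_filter /=; lia.
Qed.

Lemma part_cons h t i : is_partition (h :: t) ->
  part (strip_hook t) i.+1 = (part (h :: t) i.+2).-1.
Proof.
move=> /andP[/= st _]; apply: nth_strip_hook.
by move: st; rewrite all_geq_sorted => /andP[].
Qed.

Lemma conj_part_cons h t i : is_partition (h :: t) ->
  conj_part (strip_hook t) i.+1 = (conj_part (h :: t) i.+2).-1.
Proof.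
rewrite /is_partition /conj_part /strip_hook /= all_geq_sorted => /andP[/andP[le_h _] _].
rewrite count_map count_filter.
have -> : count [predI preim predn (leq i.+1) & leq 2] t = count (leq i.+2) t.
  by apply: eq_count => y /=; rewrite !unfold_in /=; lia.
case: (ltnP i.+1 h) => /= lt_h; first by [].
rewrite (eq_in_count (a2 := pred0)) ?count_pred0 //.
by move=> y /(allP le_h) /=; lia.
Qed.

Lemma rk_cons h t : is_partition (h :: t) -> rk (h :: t) = (rk (strip_hook t)).+1.
Proof.
move=> ht; have h_gt0 : 0 < h by case/and3P: ht.
apply: rk_eq => [|[//|[//|r]] _ le_r].
  have := rk_leq_part (strip_hook t).
  by case E : (rk _) => [//|r]; rewrite (part_cons _ ht); lia.
by rewrite ltnS; apply: leq_rk; rewrite // (part_cons _ ht); lia.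
Qed.

Lemma arms_cons h t :
  is_partition (h :: t) -> arms (h :: t) = h.-1 :: arms (strip_hook t).
Proof.
move=> ht; rewrite /arms rk_cons //= /part /= subn1; congr cons.
rewrite -[2]/(1 + 1) iotaDl -map_comp; apply/eq_in_map => -[|i].
  by rewrite mem_iota.
move=> _ /=; move: (part_cons i ht); rewrite /part /= => ->; lia.
Qed.

Lemma legs_cons h t :
  is_partition (h :: t) -> legs (h :: t) = size t :: legs (strip_hook t).
Proof.
move=> ht; rewrite /legs rk_cons //=; congr cons.
  have /and3P[_ h_gt0 /all_filterP t1] := ht.
  by rewrite /conj_part /= h_gt0 -size_filter t1; lia.
rewrite -[2]/(1 + 1) iotaDl -map_comp; apply/eq_in_map => -[|i].
  by rewrite mem_iota.
by move=> _ /=; rewrite (conj_part_cons i ht) /conj_part /= add1n; lia.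
Qed.

(* Prefixing [b] to [a] adds an outer hook with arm [b + c] and leg [b]. *)
Fixpoint frobenius (c : nat) (a : seq nat) : seq nat :=
  if a is b :: a' then
    let l := frobenius c a' in
    (b + c).+1 :: [seq i.+1 | i <- l ++ nseq (b - size l) 0]
  else [::].

Lemma frobenius_legs c l : is_partition l ->
  arms l = [seq b + c | b <- legs l] -> frobenius c (legs l) = l.
Proof.
(* The stripped partition is not a subterm of [l], hence induction on a bound for the size. *)
have [n] := ubnP (size l); elim: n l => // n IHn [|h t] //=.
  by move=> _ _ _; rewrite /legs (@rk_eq [::] 0) // => -[|r]; rewrite // /part nth_nil.
rewrite ltnS => lt_t ht.
rewrite arms_cons // legs_cons //= => -[eh earms].
have /and3P[/= st h0 at1] := ht.
have pt : is_partition t.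
  by apply/andP; split=> //; move: st; rewrite all_geq_sorted => /andP[].
rewrite IHn ?strip_hookP ?strip_hookK //; last first.
  by rewrite (leq_trans _ lt_t) // ltnS size_map size_filter count_size.
by congr cons; lia.
Qed.

Lemma size_frobenius c a : sorted gtn a ->
  size (frobenius c a) = if a is b :: _ then b.+1 else 0.
Proof.
elim: a => //= b a IHa ba; rewrite size_map size_cat size_nseq IHa ?(path_sorted ba) //.
by case: a ba {IHa} => /= [|b' a]; lia.
Qed.

Lemma size_frobenius_leq c b a :
  path gtn b a -> size (frobenius c a) <= b.
Proof.
move=> ba; rewrite size_frobenius ?(path_sorted ba) //.
by case: a ba => //= ? ? /andP[].
Qed.

Lemma strip_hook_frobenius c a n : is_partition (frobenius c a) ->
  strip_hook [seq i.+1 | i <- frobenius c a ++ nseq n 0] = frobenius c a.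
Proof.
move=> /andP[_ a1]; rewrite /strip_hook map_cat filter_cat map_cat map_nseq.
rewrite [filter _ (nseq _ _)](_ : _ = [::]); last by elim: n.
by rewrite cats0 filter_map -map_comp (eq_filter (a2 := leq 1)) ?map_id // (all_filterP a1).
Qed.

Lemma frobenius_partition c a : sorted gtn a -> is_partition (frobenius c a).
Proof.
elim: a => //= b a IHa ba.
have /andP[sl l1] := IHa (path_sorted ba).
have trans_geq : transitive geq by move=> x y z /=; lia.
rewrite /is_partition /= all_geq_sorted !all_map -andbA.
apply/and3P; split; [| |exact/allP]; last first.
  rewrite sorted_map; apply: (sub_sorted (e := geq)) => //.
  rewrite sorted_pairwise // pairwise_cat -!sorted_pairwise // sl /=.
  apply/andP; split.
    by apply/allrelP => x y _; rewrite mem_nseq => /andP[_ /eqP ->] /=.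
  by elim: (_ - _) => //= -[|n].
rewrite all_cat; apply/andP; split; last first.
  by apply/allP => y; rewrite mem_nseq => /andP[_ /eqP ->].
case: a ba sl {IHa l1} => //= b' a /andP[lt_b _].
rewrite all_geq_sorted => /andP[le_l _]; apply/andP; split => /=; first by lia.
by apply/allP => y /(allP le_l) /=; lia.
Qed.

Lemma frobenius_arms_legs c a : sorted gtn a ->
  arms (frobenius c a) = [seq b + c | b <- a] /\ legs (frobenius c a) = a.
Proof.
elim: a => [|b a IHa] /= ba.
  by rewrite /arms /legs (@rk_eq [::] 0) // => -[|r]; rewrite // /part nth_nil.
have sa := path_sorted ba; have [ea el] := IHa sa.
have := @frobenius_partition c (b :: a) ba => /= pba.
rewrite arms_cons // legs_cons // strip_hook_frobenius ?frobenius_partition //.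
rewrite ea el size_map size_cat size_nseq subnKC //.
exact: size_frobenius_leq.
Qed.

Lemma rk_frobenius c a : sorted gtn a -> rk (frobenius c a) = size a.
Proof.
by move=> /(frobenius_arms_legs c) [_ {2}<-]; rewrite size_map size_iota.
Qed.

(** A hook with leg b and arm b + c has 2b + c + 1 cells. *)
Lemma sumn_frobenius c a : sorted gtn a ->
  sumn (frobenius c a) = (sumn a).*2 + c.+1 * size a.
Proof.
have sumnS s : sumn [seq i.+1 | i <- s] = sumn s + size s by elim: s => //= x s ->; lia.
elim: a => [|b a IHa] //= ba; first by rewrite muln0.
rewrite sumnS sumn_cat sumn_nseq IHa ?(path_sorted ba) // size_cat size_nseq.
rewrite subnKC ?size_frobenius_leq //; lia.
Qed.

Lemma nth_frobenius_cons c b a i : path gtn b a -> i < b ->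
  nth 0 (frobenius c (b :: a)) i.+1 = (nth 0 (frobenius c a) i).+1.
Proof.
move=> ba lt_ib; rewrite /= (nth_map 0) ?size_cat ?size_nseq ?subnKC ?size_frobenius_leq //.
by rewrite nth_cat nth_nseq; case: ltnP => // le_i; rewrite if_same [in RHS]nth_default.
Qed.

(** Splitting on whether the largest allowed entry occurs mirrors the choice between the two terms
    of a determinant row in the expansion below. *)
Fixpoint decreasing_seqs (q : nat) : seq (seq nat) :=
  if q is p.+1 then
    decreasing_seqs p ++ [seq p :: a | a <- decreasing_seqs p]
  else [:: [::]].

Lemma gtn_path b a : path gtn b a = all (gtn b) a && sorted gtn a.
Proof. by rewrite path_sortedE // => x y z /=; lia. Qed.

Lemma mem_decreasing_seqs q a :
  (a \in decreasing_seqs q) = sorted gtn a && all (gtn q) a.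
Proof.
elim: q a => [|q IHq] a /=; first by case: a => //= b a; rewrite andbF.
rewrite mem_cat IHq; apply/orP/andP => [[/andP[sa aq]|/mapP[a' + ->]]|[sa aq]].
- by split=> //; apply: sub_all aq => y /=; lia.
- rewrite IHq => /andP[sa aq] /=; rewrite gtn_path sa aq ltnSn; split=> //.
  by apply: sub_all aq => y /=; lia.
case: a sa aq => [|b a] /=; first by left.
rewrite gtn_path => /andP[ab sa] /andP[bq aq].
have [eb | nb] := eqVneq b q; [right | left].
  by apply/mapP; exists a; rewrite ?eb // IHq sa -eb.
rewrite ab sa /=; apply/andP; split; first by lia.
by apply/allP => y /(allP ab) /=; lia.
Qed.

Lemma uniq_decreasing_seqs q : uniq (decreasing_seqs q).
Proof.
elim: q => //= q IHq; rewrite cat_uniq IHq map_inj_uniq ?IHq ?andbT /=; last by move=> ? ? [].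
apply/hasPn => _ /mapP[a _ ->]; rewrite mem_decreasing_seqs /= ltnn /=.
by rewrite andbF.
Qed.

Local Open Scope ring_scope.

(** * Expansion of the determinant into alternants *)

Lemma det_rotate_rows (R : comNzRingType) k q (g : nat -> 'I_k -> R) :
  (q < k)%N ->
  \det (\matrix_(i < k, j < k)
          (if (i == 0 :> nat) then g q j else if (i <= q)%N then g i.-1 j else g i j))
  = (-1) ^+ q * \det (\matrix_(i < k, j < k) g i j).
Proof.
elim: q g => [|q IHq] g lt_qk.
  rewrite mul1r; congr (\det _); apply/matrixP => i j; rewrite !mxE.
  by case: (val i) => [|n].
have lt_q : (q < k)%N by exact: ltnW.
pose i1 := Ordinal lt_q; pose i2 := Ordinal lt_qk.
(* Swapping rows q and q + 1 costs one sign and puts the wanted row at position q, from where the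
   induction hypothesis moves it to the top. *)
pose g' (i : nat) := g (if i == q then q.+1 else if i == q.+1 then q else i).
have := IHq g' lt_q; have -> : \det (\matrix_(i < k, j < k) g' i j)
    = - \det (\matrix_(i < k, j < k) g i j).
  have -> : \matrix_(i < k, j < k) g' i j = xrow i1 i2 (\matrix_(i < k, j < k) g i j).
    apply/matrixP => i j; rewrite !mxE /g'; case: tpermP => [->|->|].
    - by rewrite /= eqxx.
    - by rewrite /= eqxx; case: eqP => //; lia.
    move=> ni1 ni2; case: eqP => [e|_]; first by case: ni1; apply/val_inj.
    by case: eqP => [e|//]; case: ni2; apply/val_inj.
  by rewrite xrowE det_mulmx det_perm odd_tperm -val_eqE /= ltn_eqF // expr1 mulN1r.
rewrite mulrN -mulNr -mulN1r -exprS => <-; congr (\det _); apply/matrixP => i j.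
rewrite !mxE /g' eqxx; case: (val i) => //= n.
rewrite ltnS eqSS; case: (ltngtP n q) => [lt_nq|lt_qn|->] /=.
- by rewrite !ifF //; lia.
- by rewrite !ifF //; lia.
by rewrite ifF //; lia.
Qed.

(** Induction on the number q of binomial rows. The remaining rows [r] are arbitrary, so that
    multilinearity can store either term of the last binomial row there; the first term leaves [a]
    unchanged, the second prefixes the new leg. *)
Lemma det_expand_frobenius (R : comNzRingType) k c (eta : R) (x : 'I_k -> R)
    q (r : nat -> 'I_k -> R) : (q <= k)%N ->
  \det (\matrix_(i < k, j < k)
      (if (i < q)%N then x j ^+ (k - i.+1) + eta * x j ^+ (k + i + c) else r i j))
  = \sum_(a <- decreasing_seqs q) (-1) ^+ sumn a * eta ^+ size a *
      \det (\matrix_(i < k, j < k)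
        (if (i < q)%N then x j ^+ (part (frobenius c a) i.+1 + (k - i.+1)) else r i j)).
Proof.
elim: q r => [|q IHq] r lt_qk; first by rewrite big_seq1 !mul1r.
rewrite [decreasing_seqs _.+1]/= big_cat big_map.
pose P q (r : nat -> 'I_k -> R) := \matrix_(i < k, j < k)
      (if (i < q)%N then x j ^+ (k - i.+1) + eta * x j ^+ (k + i + c) else r i j).
pose r1 i j := if i == q then x j ^+ (k - q.+1) else r i j.
pose r2 i j := if i == q then x j ^+ (k + q + c) else r i j.
rewrite -/(P q.+1 r) (@determinant_multilinear _ _ _ (P q r1) (P q r2) (Ordinal lt_qk) 1 eta);
  first last.
- apply/matrixP => i j; rewrite !mxE ltnS /r2.
  have /negPf ne : lift (Ordinal lt_qk) i != q :> nat by rewrite eq_sym neq_bump.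
  by rewrite [(lift _ _ <= q)%N]leq_eqVlt ne.
- apply/matrixP => i j; rewrite !mxE ltnS /r1.
  have /negPf ne : lift (Ordinal lt_qk) i != q :> nat by rewrite eq_sym neq_bump.
  by rewrite [(lift _ _ <= q)%N]leq_eqVlt ne.
- by apply/rowP => j; rewrite !mxE /= ltnSn ltnn /r1 /r2 eqxx mul1r.
rewrite mul1r !IHq 1?ltnW // big_distrr /=; congr (_ + _).
  apply: eq_big_seq => a; rewrite mem_decreasing_seqs => /andP[sa aq].
  congr (_ * \det _); apply/matrixP => i j; rewrite !mxE ltnS /r1.
  (* A shape with all legs below q has at most q rows, so row q reads the default part 0 and keeps
     its staircase exponent. *)
  case: (ltngtP i q) => // ->; rewrite /part /= nth_default ?add0n //.
  by apply: size_frobenius_leq; rewrite gtn_path aq.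
(* Now row q carries x^(k+q+c). Rotated to the top it matches the first part q + c + 1 of
   [frobenius c (q :: a)]; the rows above it move down by one and their parts grow by one. The
   rotation sign (-1)^q supplies the new term of [sumn]. *)
apply: eq_big_seq => a; rewrite mem_decreasing_seqs => /andP[sa aq].
have pa : path gtn q a by rewrite gtn_path aq.
pose g (i : nat) (j : 'I_k) := if (i < q)%N
  then x j ^+ (part (frobenius c a) i.+1 + (k - i.+1)) else r2 i j.
rewrite [LHS](_ : _ = eta * ((-1) ^+ sumn a * eta ^+ size a) *
    \det (\matrix_(i < k, j < k) g i j)); last by rewrite mulrA.
rewrite [RHS](_ : _ = eta * ((-1) ^+ sumn a * eta ^+ size a) *
    ((-1) ^+ q * \det (\matrix_(i < k, j < k)
      (if (i < q.+1)%N
       then x j ^+ (part (frobenius c (q :: a)) i.+1 + (k - i.+1)) else r i j)))); last first.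
  by rewrite exprD exprS; ring.
congr (_ * _); apply: (can_inj (signrMK q)); rewrite signrMK -det_rotate_rows //.
congr (\det _); apply/matrixP => i j; rewrite !mxE /g /r2.
case: i => -[|i] /= lt_ik; first by rewrite ltnn eqxx; congr (_ ^+ _); rewrite /part /=; lia.
rewrite !ltnS; case: (ltngtP i q) => [lt_iq|lt_qi|eiq].
- congr (_ ^+ _); rewrite /part -[RHS]/(nth 0%N (frobenius c (q :: a)) i.+1 + _)%N.
  rewrite nth_frobenius_cons // addSnnS; congr (_ + _)%N.
  by rewrite subnSK.
- by rewrite !ifF //; lia.
by rewrite !ifF //; lia.
Qed.

Lemma det_expand_alternant k c (eta : {mpoly rat[k]}) :
  \det (\matrix_(i < k, j < k)
     ('X_j ^+ (k - i.+1) + eta * 'X_j ^+ (k + i + c)))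
  = \sum_(a <- decreasing_seqs k) (-1) ^+ sumn a * eta ^+ size a *
      alternant k (frobenius c a).
Proof.
have := det_expand_frobenius c eta (fun j => 'X_j) (fun _ _ => 0) (leqnn k).
rewrite (_ : \matrix_(i, j) _ = \matrix_(i < k, j < k)
     ('X_j ^+ (k - i.+1) + eta * 'X_j ^+ (k + i + c))) => [->|]; last first.
  by apply/matrixP => i j; rewrite !mxE ltn_ord.
apply: eq_bigr => a _; congr (_ * \det _).
by apply/matrixP => i j; rewrite !mxE ltn_ord.
Qed.

Lemma frobenius_shiftP c l :
  frobenius_shift c l <-> exists2 a, sorted gtn a & l = frobenius c a.
Proof.
split=> [[pl [a [sa ea el]]]|[a sa ->]].
  by exists a => //; rewrite -el frobenius_legs // el.
have [ea el] := frobenius_arms_legs c sa.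
by split; [exact: frobenius_partition | exists a].
Qed.

(** A shape whose first leg is at least k has more than k rows, so its Schur polynomial is 0 and
    only finitely many shapes remain. *)
Lemma sum_frobenius_shift k c (sg : seq nat -> {fraction {mpoly rat[k]}}) :
  \sum_(l \in frobenius_shift c) sg l * schur k l
  = (\sum_(a <- decreasing_seqs k) sg (frobenius c a) * tofrac (alternant k (frobenius c a)))
    / tofrac (alternant k [::]).
Proof.
have frob_inj : {in decreasing_seqs k &, injective (frobenius c)}.
  move=> a b; rewrite !mem_decreasing_seqs => /andP[sa _] /andP[sb _] e.
  by rewrite -(frobenius_arms_legs c sa).2 e (frobenius_arms_legs c sb).2.
have size_frob a : a \in decreasing_seqs k -> (size (frobenius c a) <= k)%N.
  by rewrite mem_decreasing_seqs => /andP[sa ak]; apply: size_frobenius_leq; rewrite gtn_path ak.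
rewrite -(fsbig_widen [set` [seq frobenius c a | a <- decreasing_seqs k]]).
- rewrite -fsbig_seq ?map_inj_in_uniq ?uniq_decreasing_seqs // big_map big_distrl /=.
  by apply: eq_big_seq => a /size_frob; rewrite /schur => ->; rewrite mulrA.
- move=> l /= /mapP[a + ->]; rewrite mem_decreasing_seqs => /andP[sa _].
  by apply/frobenius_shiftP; exists a.
move=> l [/frobenius_shiftP[a sa ->] /= na]; rewrite /schur ifF ?mulr0 //.
apply: contra_notF na => sz; apply: map_f.
rewrite mem_decreasing_seqs sa /=; move: sz; rewrite size_frobenius //.
case: a sa => //= b a; rewrite gtn_path => /andP[ab _] bk; rewrite bk /=.
by apply: sub_all ab => y /=; lia.
Qed.

(** * Complementary minors and the kernel relation *)

Section ComplementaryMinors.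
Variables (R : comNzRingType) (m : nat).

(** Each unit row is removed by Laplace expansion, contributing (-1)^m as it stands below the m rows
    of [K]. What is left is columns k to k + m - 1 of [K], lower triangular with diagonal c. *)
Lemma det_complete_basis k n (K : nat -> nat -> R) c :
  n = (m + k)%N ->
  (forall r, (r < m)%N -> K r (k + r)%N = c) ->
  (forall r p, (r < m)%N -> (k + r < p)%N -> K r p = 0) ->
  \det (\matrix_(i < n, j < n) (if (i < m)%N then K i j else (i - m == j)%N%:R))
  = (-1) ^+ (m * k) * c ^+ m.
Proof.
elim: k n K => [|k IHk] n K en Kc K0.
  rewrite muln0 mul1r; rewrite addn0 in en; subst n.
  rewrite det_trig; last first.
    by apply/is_trig_mxP => i j lt_ij; rewrite mxE ltn_ord K0.
  by rewrite -[in RHS](card_ord m) -prodr_const; apply: eq_bigr => i _; rewrite mxE ltn_ord Kc.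
rewrite addnS in en; subst n.
have lt_m : (m < (m + k).+1)%N by rewrite ltnS leq_addr.
rewrite (expand_det_row _ (Ordinal lt_m)) (bigD1 ord0) //= big1 ?addr0; last first.
  by move=> j /negPf nj; rewrite mxE /= ltnn subnn eq_sym (_ : (j == 0%N :> nat) = false) ?mul0r.
rewrite mxE /= ltnn subnn eqxx mul1r /cofactor /= addn0 mulnS exprD -mulrA; congr (_ * _).
rewrite -(IHk _ (fun r p => K r p.+1) erefl); last first.
- by move=> r p lt_r lt_p; apply: K0; rewrite // addSn.
- by move=> r lt_r; rewrite -addSn Kc.
congr (\det _); apply/matrixP => i j; rewrite !mxE !lift0 /= /bump.
by case: (ltnP i m) => lt_i; rewrite ?add0n ?add1n ?lt_i // ltnNge (leqW lt_i) /= subSn.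
Qed.

(* The kernel of the evaluations [E] is spanned by the
   rows of [K], so the minor of [E] on the last [k] basis elements is
   proportional to the minor of [K] on the first [m]. *)
Lemma det_complementary_minor k (K : nat -> nat -> R) (E : nat -> 'I_k -> R) c :
  (forall r j, (r < m)%N -> \sum_(p < m + k) K r p * E p j = 0) ->
  (forall r, (r < m)%N -> K r (k + r)%N = c) ->
  (forall r p, (r < m)%N -> (k + r < p)%N -> K r p = 0) ->
  (-1) ^+ (m * k) * c ^+ m * \det (\matrix_(i < k, j < k) E (m + i)%N j)
  = \det (\matrix_(r < m, p < m) K r p) * \det (\matrix_(i < k, j < k) E i j).
Proof.
move=> KE Kc K0; rewrite -(det_complete_basis erefl Kc K0).
pose E1 := \matrix_(i < m, j < k) E i j.
pose E2 := \matrix_(i < k, j < k) E (m + i)%N j.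
pose d1 := \matrix_(i < k, j < m) (i == j :> nat)%:R : 'M[R]_(k, m).
pose d2 := \matrix_(i < k, j < k) (i == m + j :> nat)%N%:R : 'M[R]_(k, k).
pose K1 := \matrix_(r < m, p < m) K r p.
pose K2 := \matrix_(r < m, p < k) K r (m + p)%N.
rewrite (_ : (\matrix_(i, j) _) = block_mx K1 K2 d1 d2); last first.
  apply/matrixP => i j; rewrite -[i]splitK -[j]splitK.
  case: (split i) => i'; case: (split j) => j' /=;
    rewrite ?block_mxEul ?block_mxEur ?block_mxEdl ?block_mxEdr !mxE /= ?ltn_ord //;
    by rewrite ltnNge leq_addr addKn.
(* Multiplying the completed matrix by this block matrix evaluates its rows: those of [K] give a
   zero upper right block, and the unit rows select the first k evaluations. *)
have <- : \det (block_mx 1%:M E1 0 E2) = \det E2 by rewrite det_ublock det1 mul1r.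
rewrite -det_mulmx mulmx_block !mulmx1 !mulmx0 !addr0.
have sumE j (G : nat -> R) : \sum_(p < m) G p * E1 p j + \sum_(p < k) G (m + p)%N * E2 p j
    = \sum_(p < m + k) G p * E p j.
  by rewrite big_split_ord; congr (_ + _); apply: eq_bigr => p _; rewrite !mxE.
rewrite (_ : K1 *m E1 + K2 *m E2 = 0).
  rewrite (_ : d1 *m E1 + d2 *m E2 = \matrix_(i < k, j < k) E i j) ?det_lblock //.
  apply/matrixP => i j; rewrite !mxE; under eq_bigr do rewrite [d1 _ _]mxE.
  under [X in _ + X]eq_bigr do rewrite [d2 _ _]mxE.
  rewrite (sumE j (fun p => (i == p :> nat)%N%:R)).
  have lt_i : (i < m + k)%N by rewrite ltn_addl.
  rewrite (bigD1 (Ordinal lt_i)) //= eqxx mul1r big1 ?addr0 // => p ne.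
  by rewrite eq_sym (_ : (p == i :> nat) = false) ?mul0r //; apply: negbTE; move: ne.
apply/matrixP => i j; rewrite !mxE -[RHS](KE i j (ltn_ord i)) -(sumE j).
by congr (_ + _); apply: eq_bigr => p _; rewrite !mxE.
Qed.

End ComplementaryMinors.

Section KernelRelation.
Variables (L : fieldType) (k : nat) (h : nat -> L).
Hypothesis h_gt : forall j, (k < j)%N -> h j = 0.
Hypothesis two_neq0 : 2%:R != 0 :> L.

(** For z nonzero, a zero of the symmetric Laurent polynomial with coefficients [h] at |i| up to k;
    the factor z^k keeps exponents natural. *)
Definition laurent_root (z : L) : Prop :=
  \sum_(i < k + k.+1) h `|i%:Z - k%:Z|%N * z ^+ i = 0.

Lemma laurent_root_shift z M r : laurent_root z -> (k <= r)%N -> (r + k < M)%N ->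
  \sum_(i < M) h `|i%:Z - r%:Z|%N * z ^+ i = 0.
Proof.
move=> z0 le_kr lt_M.
rewrite -(big_mkord xpredT (fun i => h `|i%:Z - r%:Z|%N * z ^+ i)).
rewrite (@big_cat_nat _ _ _ (r - k)) //=; last by lia.
rewrite (@big_cat_nat _ _ _ (r + k).+1 (r - k)) //=; last by lia.
rewrite big_nat big1 ?add0r; last by move=> i i_lt; rewrite h_gt ?mul0r //; lia.
rewrite [X in _ + X]big_nat [X in _ + X]big1 ?addr0; last first.
  by move=> i i_lt; rewrite h_gt ?mul0r //; lia.
rewrite -{1}[(r - k)%N]add0n big_addn (_ : (r + k).+1 - (r - k) = k + k.+1)%N; last by lia.
rewrite big_mkord -[RHS](mulr0 (z ^+ (r - k))) -[X in _ = _ * X]z0 big_distrr /=.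
apply: eq_bigr => i _.
by rewrite mulrCA -exprD addnC; congr (h _ * _); lia.
Qed.

(** This is z^n times the Laurent relation, sorted by the sign of the exponent. The bounds on N and
    N' ensure that the window contains every nonzero coefficient. *)
Lemma laurent_root_split z n N N' : z != 0 -> laurent_root z ->
    (n + k < N)%N -> (k <= N')%N ->
  \sum_(p < N) h `|p%:Z - n%:Z|%N * z ^+ p
  + \sum_(q < N') h (q.+1 + n)%N * z ^- q.+1 = 0.
Proof.
move=> z_neq0 z0 lt_N le_N'.
have := @laurent_root_shift z (N' + N) (N' + n) z0; rewrite big_split_ord /= => E.
apply: (mulfI (expf_neq0 N' z_neq0)); rewrite mulr0 -[RHS]E; try lia.
rewrite mulrDr addrC !big_distrr /=; congr (_ + _).
  by apply: eq_bigr => i _; rewrite mulrCA -exprD; congr (h _ * _); lia.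
rewrite (reindex_inj rev_ord_inj); apply: eq_bigr => i _ /=.
have lt_i := ltn_ord i; rewrite mulrCA; congr (h _ * _); first by lia.
by rewrite subnSK // -{1}(subnK (ltnW lt_i)) addnC exprD mulfK ?expf_neq0.
Qed.

(* For d = 0 the function x^-n + x^n is halved at n = 0; this is the origin of the
   factor 1/2 in the third identity. *)
Definition weight (d n : nat) : L := if (d == 0)%N && (n == 0)%N then 2%:R^-1 else 1.

Definition folded (d : nat) (eta x : L) (p : nat) : L :=
  weight d p * (x ^- p + eta * x ^+ (p + d)).

Definition toeplitz_hankel (d : nat) (eps : L) (n p : nat) : L :=
  h `|p%:Z - n%:Z|%N + eps * h (p + n + d)%N.

(* d = 1, 2, 0 correspond to the first, second and third identity. *)
Definition case_sign (d : nat) : L := if d is 2 then -1 else 1.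

(** Put eta = (-1)^d [case_sign d]. Adding to the split relation at -1/x the one at -x times eta x^d
    attaches (-1)^p (x^-p + eta x^(p+d)) to exponent p. The reflection of p to -p - d multiplies
    this by [case_sign d], so negative exponents fold onto p >= 0 and produce the Hankel term. *)
Lemma kernel_relation d n N x : (d <= 2)%N -> x != 0 ->
    laurent_root (- x) -> laurent_root (- x^-1) -> (n + k < N)%N ->
  \sum_(p < N) (-1) ^+ p * toeplitz_hankel d (case_sign d) n p
                * folded d ((-1) ^+ d * case_sign d) x p = 0.
Proof.
move=> le_d2 x_neq0 root_x root_xV lt_N.
have nx_neq0 : - x != 0 by rewrite oppr_eq0.
have nxV_neq0 : - x^-1 != 0 by rewrite oppr_eq0 invr_eq0.
have le_N : (k <= N)%N by lia.
have split_x N' := @laurent_root_split _ n N N' nx_neq0 root_x lt_N.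
have split_xV N' := @laurent_root_split _ n N N' nxV_neq0 root_xV lt_N.
rewrite /folded /toeplitz_hankel.
case: d le_d2 => [|[|[|//]]] _ /=.
(* For d = 0 exponent 0 is its own mirror image: there h_n times the value 2 must equal the doubled
   coefficient 2 h_n times the halved value 1. *)
- case: N lt_N le_N split_x split_xV => // N lt_N le_N split_x split_xV.
  have le_kN : (k <= N)%N by lia.
  have := f_equal2 (fun a b => a + b) (split_xV N le_kN) (split_x N le_kN).
  rewrite /= addr0 ![\sum_(p < N.+1) _]big_ord_recl /= => E.
  rewrite (_ : \sum_(p < N) _ =
      \sum_(p < N) h `|bump 0 p - n|%N * (- x^-1) ^+ bump 0 p
      + \sum_(p < N) h (p.+1 + n)%N * (- x^-1) ^- p.+1
      + (\sum_(p < N) h `|bump 0 p - n|%N * (- x) ^+ bump 0 p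
      + \sum_(p < N) h (p.+1 + n)%N * (- x) ^- p.+1)); last first.
    rewrite -!big_split /=; apply: eq_bigr => p _; rewrite /bump !add1n !addn0.
    rewrite /weight /= !(exprNn x) !(exprNn x^-1) !exprVn ?addn0 ![_ ^+ p.+1]exprS.
    rewrite !invfM !invrK !invr_sign.
    have := expf_neq0 p x_neq0; move: (x ^+ p) => y y_neq0.
    rewrite !invrN !invr1.
    by field; rewrite y_neq0.
  rewrite -[RHS]E (_ : `|0%:Z - n%:Z|%N = n); last by lia.
  rewrite /weight /= !expr0 !add0n !addn0.
  by field; rewrite oner_eq0.
- have e1 := split_x N le_N; have e2 := split_xV N le_N.
  have := f_equal2 (fun a b => a + - x * b) e2 e1; rewrite /= mulr0 addr0 => E.
  rewrite -[RHS]E -!big_split big_distrr -big_split /=.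
  apply: eq_bigr => p _; rewrite /weight /=.
  rewrite !(exprNn x) !(exprNn x^-1) !exprVn addn1 addSn addn1 expr1 ![_ ^+ p.+1]exprS.
  rewrite !invfM !invrK !invr_sign.
  have := expf_neq0 p x_neq0; move: (x ^+ p) => y y_neq0.
  rewrite !invrN !invr1.
  by field; rewrite ?y_neq0.
(* For d = 2 exponent -1 is fixed by the reflection with sign -1, so its term cancels. It is split
   off, and one more negative exponent is taken to keep N of them. *)
- have e1 := split_x N.+1 (leqW le_N); have e2 := split_xV N.+1 (leqW le_N).
  have := f_equal2 (fun a b => a + - x ^+ 2 * b) e2 e1; rewrite /= mulr0 addr0.
  rewrite ![\sum_(q < N.+1) _]big_ord_recl /= => E.
  rewrite [LHS](_ : _ =
      \sum_(p < N) h `|p%:Z - n%:Z|%N * (- x^-1) ^+ p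
      + \sum_(p < N) h ((bump 0 p).+1 + n)%N * (- x^-1) ^- (bump 0 p).+1
      + - x ^+ 2 * (\sum_(p < N) h `|p%:Z - n%:Z|%N * (- x) ^+ p
      + \sum_(p < N) h ((bump 0 p).+1 + n)%N * (- x) ^- (bump 0 p).+1)); last first.
    rewrite -!big_split big_distrr -big_split /=; apply: eq_bigr => p _.
    rewrite /bump !add1n addn2 addSn addSn addn2.
    rewrite ![_ ^+ p.+2]exprS.
    rewrite /weight /= !(exprNn x) !(exprNn x^-1) !exprVn ?addn0 ![_ ^+ p.+1]exprS.
    rewrite !invfM !invrK !invr_sign.
    have := expf_neq0 p x_neq0; move: (x ^+ p) => y y_neq0.
    rewrite !invrN !invr1.
    by field; rewrite y_neq0 x_neq0 oner_eq0.
  rewrite -[RHS]E !expr1.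
  by field; rewrite !oppr_eq0 x_neq0 oner_eq0.
Qed.
End KernelRelation.

(** * Evaluation of the determinant *)

(** The coefficient matrix is unitriangular, so passing from powers to monic polynomials preserves
    the Vandermonde determinant. *)
Lemma det_monic_horner (R : comNzRingType) k (P : nat -> {poly R}) (u : 'I_k -> R) :
  (forall n, size (P n) = n.+1) -> (forall n, P n \is monic) ->
  \det (\matrix_(i < k, j < k) (P i).[u j])
  = \prod_(i < k) \prod_(j < k | (i < j)%N) (u j - u i).
Proof.
move=> sizeP monP.
rewrite (_ : (\matrix_(i, j) _) =
  (\matrix_(i < k, l < k) (P i)`_l) *m Vandermonde k (\row_j u j)); last first.
  apply/matrixP => i j; rewrite !mxE (horner_coef_wide (n := k)) ?sizeP //.
  by apply: eq_bigr => l _; rewrite !mxE.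
rewrite det_mulmx det_Vandermonde det_trig; last first.
  by apply/is_trig_mxP => i j lt_ij; rewrite mxE nth_default // sizeP.
rewrite big1 ?mul1r => [|i _]; last first.
  by rewrite mxE -[nat_of_ord i]/(i.+1.-1) -{2}sizeP; exact/eqP/monP.
by apply: eq_bigr => i _; apply: eq_bigr => j _; rewrite !mxE.
Qed.

(** Monic Chebyshev-type polynomials in y + 1/y: the shift [a] of the linear one and the
    coefficients [q] select the kind. *)
Fixpoint three_term (R : comNzRingType) (a : R) (q : nat -> R) (n : nat) : {poly R} :=
  match n with
  | 0 => 1
  | 1 => 'X + a%:P
  | (p.+1 as p1).+1 => 'X * three_term a q p1 - q p *: three_term a q p
  end.

Lemma three_term_monic (R : comNzRingType) (a : R) (q : nat -> R) n :
  size (three_term a q n) = n.+1 /\ three_term a q n \is monic.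
Proof.
suff H : (size (three_term a q n) = n.+1 /\ three_term a q n \is monic) /\
    (size (three_term a q n.+1) = n.+2 /\ three_term a q n.+1 \is monic).
  by case: H.
elim: n => [|n [[s0 m0] [s1 m1]]].
  by rewrite /= size_poly1 monic1 size_XaddC monicXaddC.
split=> //.
have sX : size ('X * three_term a q n.+1) = n.+3.
  by rewrite mulrC size_mulX ?monic_neq0 // s1.
have lt_s : (size (- (q n *: three_term a q n))%R < size ('X * three_term a q n.+1)%R)%N.
  by rewrite size_polyN sX (leq_ltn_trans (size_scale_leq _ _)) // s0.
split; first by rewrite -sX; apply: size_polyDl.
by rewrite monicE lead_coefDl // mulrC lead_coefMX -monicE.
Qed.

Lemma det_scale_cols (R : comNzRingType) n (v : 'I_n -> R) (A : 'I_n -> 'I_n -> R) :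
  \det (\matrix_(i < n, j < n) (v j * A i j))
  = (\prod_j v j) * \det (\matrix_(i < n, j < n) A i j).
Proof.
rewrite (_ : (\matrix_(i, j) _) = (\matrix_(i < n, j < n) A i j) *m diag_mx (\row_j v j)).
  rewrite det_mulmx det_diag mulrC; congr (_ * _); apply: eq_bigr => j _; by rewrite mxE.
by apply/matrixP => i j; rewrite mul_mx_diag !mxE mulrC.
Qed.

Lemma det_scale_rows (R : comNzRingType) n (v : 'I_n -> R) (A : 'I_n -> 'I_n -> R) :
  \det (\matrix_(i < n, j < n) (v i * A i j))
  = (\prod_i v i) * \det (\matrix_(i < n, j < n) A i j).
Proof.
rewrite (_ : (\matrix_(i, j) _) = diag_mx (\row_i v i) *m (\matrix_(i < n, j < n) A i j)).
  by rewrite det_mulmx det_diag; congr (_ * _); apply: eq_bigr => j _; rewrite mxE.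
by apply/matrixP => i j; rewrite mul_diag_mx !mxE.
Qed.

Section FoldedDeterminant.
Variables (L : fieldType) (k : nat) (x : 'I_k -> L).
Hypothesis x_neq0 : forall j, x j != 0.

Lemma det_staircase :
  \det (\matrix_(i < k, j < k) x j ^+ (k - i.+1))
  = (\prod_j x j ^+ k.-1) * \prod_(i < k) \prod_(j < k | (i < j)%N) ((x j)^-1 - (x i)^-1).
Proof.
rewrite -(@det_monic_horner _ _ (fun n => 'X^n)); last 2 first.
- by move=> n; rewrite size_polyXn.
- by move=> n; rewrite monicXn.
rewrite -det_scale_cols; congr (\det _); apply/matrixP => i j; rewrite !mxE hornerXn.
have lt_i := ltn_ord i; rewrite exprVn (_ : k.-1 = k - i.+1 + i)%N; last by lia.
by rewrite exprD mulfK ?expf_neq0.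
Qed.

Lemma staircase_neq0 : injective x -> \det (\matrix_(i < k, j < k) x j ^+ (k - i.+1)) != 0.
Proof.
move=> x_inj; rewrite det_staircase mulf_neq0 //.
  by apply/prodf_neq0 => j _; rewrite expf_neq0.
apply/prodf_neq0 => i _; apply/prodf_neq0 => j lt_ij.
rewrite subr_eq0 (inj_eq invr_inj) (inj_eq x_inj).
by move: lt_ij; rewrite ltn_neqAle eq_sym => /andP[].
Qed.

Hypothesis two_neq0 : 2%:R != 0 :> L.

Local Notation eta d := ((-1) ^+ d * case_sign L d).

Definition diagonal_factor d (y : L) : L :=
  if d is d'.+1 then 1 - y ^+ d else 1.

(** Both y^-n and y^n satisfy w_(n+2) = (y + 1/y) w_(n+1) - w_n, so two initial values decide. For d
    = 0 the coefficient 2 at n = 0 undoes the halving of the initial function. *)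
Lemma folded_three_term d y n : (d <= 2)%N -> y != 0 ->
  folded d (eta d) y n
  = diagonal_factor d y
    * (three_term (if d == 1%N then 1 else 0)
         (fun n => if (d == 0)%N && (n == 0)%N then 2%:R else 1) n).[y + y^-1].
Proof.
move=> le_d2 y_neq0; set a := if d == 1%N then _ else _; set q := fun _ => _.
suff H : folded d (eta d) y n = diagonal_factor d y * (three_term a q n).[y + y^-1] /\
    folded d (eta d) y n.+1 = diagonal_factor d y * (three_term a q n.+1).[y + y^-1].
  by case: H.
elim: n => [|n [IH0 IH1]].
  rewrite /= hornerE !hornerE /folded /a /weight.
  by case: d le_d2 {a q} => [|[|[|//]]] _ /=; split; field; rewrite ?oner_eq0 ?y_neq0.
split=> //.
rewrite [three_term _ _ _]/= -/(three_term a q n) -/(three_term a q n.+1).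
rewrite hornerD hornerN hornerM hornerX hornerZ mulrBr.
rewrite [X in X - _]mulrCA -IH1 [X in _ - X]mulrCA -IH0.
rewrite /folded /weight /q andbF mul1r.
rewrite !addSn ![_ ^+ n.+2]exprS ![_ ^+ n.+1]exprS [_ ^+ (n + d).+2]exprS.
rewrite [_ ^+ (n + d).+1]exprS exprD.
have := expf_neq0 n y_neq0; move: (y ^+ n) => z z_neq0.
case: d le_d2 {a q IH0 IH1} => [|[|[|//]]] _ /=; last 2 first.
- by field; rewrite ?oner_eq0 ?y_neq0 ?z_neq0.
- by field; rewrite ?oner_eq0 ?y_neq0 ?z_neq0.
by case: (n == 0)%N; field; rewrite ?two_neq0 ?oner_eq0 ?y_neq0 ?z_neq0.
Qed.


(** Two Vandermonde determinants are compared through x_j + 1/x_j - x_i - 1/x_i = (1/x_j - 1/x_i)(1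
    - x_i x_j). *)
Lemma det_folded d : (d <= 2)%N ->
  (\prod_j x j ^+ k.-1) * \det (\matrix_(i < k, j < k) folded d (eta d) (x j) i)
  = (\prod_j diagonal_factor d (x j)
     * \prod_(i < k) \prod_(j < k | (i < j)%N) (1 - x i * x j))
    * \det (\matrix_(i < k, j < k) x j ^+ (k - i.+1)).
Proof.
move=> le_d2; rewrite det_staircase mulrCA; congr (_ * _).
under eq_mx do rewrite folded_three_term //.
rewrite det_scale_cols (det_monic_horner (fun j => x j + (x j)^-1)); last 2 first.
- by move=> n; exact: (three_term_monic _ _ n).1.
- by move=> n; exact: (three_term_monic _ _ n).2.
rewrite -mulrA; congr (_ * _); rewrite -big_split /=; apply: eq_bigr => i _.
rewrite -big_split /=; apply: eq_bigr => j _.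
by field; rewrite !x_neq0.
Qed.

(** Column j has the factor x_j^(k-1+m); dividing it out centres row i at p = m + i, where the
    weight is 1 because m > 0. *)
Lemma det_shifted_folded d m eta : (0 < m)%N ->
  \det (\matrix_(i < k, j < k)
     (x j ^+ (k - i.+1) + eta * x j ^+ (k + i + (2 * m + d - 1))))
  = (\prod_j x j ^+ k.-1) * ((\prod_j x j) ^+ m *
     \det (\matrix_(i < k, j < k) folded d eta (x j) (m + i))).
Proof.
move=> m_gt0; rewrite mulrA -prodrXl -big_split -det_scale_cols /=.
congr (\det _); apply/matrixP => i j; rewrite !mxE /folded /weight.
rewrite addn_eq0 (gtn_eqF m_gt0) andbF mul1r mulrDr; have lt_i := ltn_ord i.
rewrite -exprD (_ : k.-1 + m = k - i.+1 + (m + i))%N; last by lia.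
rewrite [x j ^+ (k - i.+1 + _)]exprD mulfK ?expf_neq0 // [in RHS]mulrCA -!exprD.
by congr (_ + _ * _ ^+ _); lia.
Qed.

Variables (h : nat -> L) (m d : nat).
Hypothesis h_gt : forall j, (k < j)%N -> h j = 0.
Hypothesis h_top : h k = \prod_j x j.
Hypothesis x_root : forall j, laurent_root k h (- x j) /\ laurent_root k h (- (x j)^-1).
Hypothesis m_gt0 : (0 < m)%N.
Hypothesis le_d2 : (d <= 2)%N.

Lemma det_rectangular :
  \det (\matrix_(i < k, j < k)
     (x j ^+ (k - i.+1) + eta d * x j ^+ (k + i + (2 * m + d - 1))))
  = ((\prod_j diagonal_factor d (x j)
     * \prod_(i < k) \prod_(j < k | (i < j)%N) (1 - x i * x j))
     * (weight L d 0 * \det (\matrix_(s < m, t < m) toeplitz_hankel h d (case_sign L d) s t)))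
    * \det (\matrix_(i < k, j < k) x j ^+ (k - i.+1)).
Proof.
rewrite det_shifted_folded // [RHS]mulrAC -det_folded // -mulrA; congr (_ * _).
(* The sign and weight of row r make the entry in column k + r equal to (-1)^k h_k for every r. Then
   (-1)^(mk) cancels against the m-th power of (-1)^k, leaving the product of the x_j to the power
   m. *)
pose K r p := (-1) ^+ r * weight L d r * ((-1) ^+ p * toeplitz_hankel h d (case_sign L d) r p).
have := @det_complementary_minor _ m k K (fun p j => folded d (eta d) (x j) p) ((-1) ^+ k * h k).
rewrite exprMn mulrA -exprM [(k * m)%N]mulnC -exprD addnn -mul2n exprM sqrrN !expr1n mul1r h_top.
move=> -> //.
- rewrite mulrC; congr (_ * _); rewrite det_scale_rows det_scale_cols mulrA; congr (_ * _).
  rewrite big_split /= mulrAC -big_split /= big1 ?mul1r => [|i _]; last by rewrite -expr2 sqrr_sign.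
  case: m m_gt0 => // m' _; rewrite big_ord_recl big1 ?mulr1 // => i _.
  by rewrite /weight andbF.
- move=> r j lt_rm; have [r1 r2] := x_root j.
  rewrite -[RHS](mulr0 ((-1) ^+ r * weight L d r)).
  rewrite -[X in _ = _ * X](@kernel_relation _ k h h_gt two_neq0 d r (m + k) (x j) le_d2) //;
    last by lia.
  by rewrite big_distrr /=; apply: eq_bigr => p _; rewrite /K !mulrA.
- move=> r lt_rm; rewrite /K /toeplitz_hankel -h_top.
  rewrite (_ : `|(k + r)%N%:Z - r%:Z|%N = k); last by lia.
  (* The Hankel index k + 2r + d exceeds k unless d = r = 0; in that case the entry is 2 h_k and the
     weight halves it. *)
  have top : weight L d r * (h k + case_sign L d * h (k + r + r + d)) = h k.
    rewrite /weight; case: ifP => [/andP[/eqP -> /eqP ->]|/negbT dr]; last first.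
      by rewrite [h (_ + d)]h_gt ?mulr0 ?addr0 ?mul1r //; lia.
    by rewrite !addn0 mul1r; field; rewrite ?oner_eq0 ?two_neq0.
  rewrite exprD -[in RHS]top; have := sqrr_sign L r; move: ((-1) ^+ r) => s s2.
  by rewrite -[RHS]mul1r -[X in _ = X * _]s2; ring.
move=> r p lt_rm lt_p; rewrite /K /toeplitz_hankel !h_gt ?mulr0 ?addr0 ?mulr0 //; lia.
Qed.

End FoldedDeterminant.

(** * The generating function of the f_i *)

Section GeneratingFunctions.
Variables (R : comNzRingType) (k : nat).

Lemma sum_mesym (S : comNzRingType) (phi : {rmorphism {mpoly R[k]} -> S}) (z : S) :
  \sum_(a < k.+1) phi (mesym k R a) * z ^+ a = \prod_(j < k) (1 + phi 'X_j * z).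
Proof.
under [RHS]eq_bigr do rewrite addrC.
rewrite bigA_distr /=.
have card_lt (J : {set 'I_k}) : (#|J| < k.+1)%N.
  by rewrite ltnS -[k in (_ <= k)%N]card_ord max_card.
rewrite (partition_big (fun J => Ordinal (card_lt J)) xpredT) //=.
apply: eq_bigr => a _; rewrite /mesym rmorph_sum big_distrl /=.
apply: eq_big => J; first by rewrite -val_eqE.
move=> /eqP <-; rewrite rmorph_prod -prodr_const -big_split /=.
rewrite [RHS](bigID (mem J)) /= [X in _ * X]big1 ?mulr1.
  by apply: eq_bigr => i ->.
by move=> i /negPf ->.
Qed.

Lemma fE (i : int) : f k i =
  \sum_(j < k.+1) mesym k rat j * mesym k rat (`|i| + j)%N.
Proof.
rewrite /f (big_ord_widen k.+1 (fun j => mesym k rat j * mesym k rat (`|i| + j)%N)) ?leq_subr //.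
rewrite big_mkcond; apply: eq_bigr => j _; case: ltnP => // le_j.
by rewrite [mesym _ _ (_ + _)]mesym_geqnE ?mulr0 //; lia.
Qed.

(** The pair (a, b) contributes to exponent i = a + k - b. For i >= k the inner sum is indexed by b,
    for i < k by a, which is why the absolute value appears. *)
Lemma sum_f (L : fieldType) (e : nat -> L) (z : L) :
  (forall j, (k < j)%N -> e j = 0) ->
  \sum_(i < k + k.+1) (\sum_(j < k.+1) e j * e (`|i%:Z - k%:Z| + j)%N) * z ^+ i
  = (\sum_(a < k.+1) e a * z ^+ a) * (\sum_(b < k.+1) e b * z ^+ (k - b)).
Proof.
move=> e0; rewrite big_distrlr /=.
transitivity (\sum_(a < k.+1) \sum_(b < k.+1) \sum_(i < k + k.+1)
    (if (i == a + (k - b) :> nat)%N then e a * e b * z ^+ i else 0)); last first.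
  apply: eq_bigr => a _; apply: eq_bigr => b _.
  have lt_ab : (a + (k - b) < k + k.+1)%N by have := ltn_ord a; lia.
  by rewrite -big_mkcond (big_pred1 (Ordinal lt_ab)) //= exprD; ring.
rewrite [RHS](_ : _ = \sum_(i < k + k.+1) \sum_(a < k.+1) \sum_(b < k.+1)
    (if (i == a + (k - b) :> nat)%N then e a * e b * z ^+ i else 0)); last first.
  by rewrite [RHS]exchange_big; apply: eq_bigr => a _; rewrite exchange_big.
apply: eq_bigr => i _; rewrite big_distrl /=.
case: (leqP k i) => [le_ki|lt_ik].
  rewrite [RHS]exchange_big; apply: eq_bigr => b _; rewrite -big_mkcond /=.
  case: (ltnP (i - k + b) k.+1) => [lt_b|le_b].
    rewrite (big_pred1 (Ordinal lt_b)) /=.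
      by rewrite (_ : `|i%:Z - k%:Z|%N = i - k)%N; [ring | lia].
    by move=> a; rewrite -[RHS]val_eqE /=; have := ltn_ord b; lia.
  rewrite big_pred0 => [|a]; last by have := ltn_ord a; have := ltn_ord b; lia.
  by rewrite [e (_ + _)]e0 ?mulr0 ?mul0r //; lia.
apply: eq_bigr => a _; rewrite -big_mkcond /=.
case: (ltnP (k - i + a) k.+1) => [lt_b|le_b].
  rewrite (big_pred1 (Ordinal lt_b)) /=.
    by rewrite (_ : `|i%:Z - k%:Z|%N = k - i)%N //; lia.
  by move=> b; rewrite -[RHS]val_eqE /=; have := ltn_ord b; lia.
rewrite big_pred0 => [|b]; last by have := ltn_ord a; have := ltn_ord b; lia.
by rewrite [e (_ + _)]e0 ?mulr0 ?mul0r //; lia.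
Qed.

End GeneratingFunctions.

(** * The signed Schur sums in the fraction field *)

Section Main.
Variable k : nat.
Local Notation K := {fraction {mpoly rat[k]}}.
Local Notation x := (fun j : 'I_k => tofrac ('X_j : {mpoly rat[k]})).
Local Notation h := (fun j : nat => tofrac (f k j%:Z)).

Lemma two_neq0_fraction : 2%:R != 0 :> K.
Proof.
rewrite -(rmorph_nat (@tofrac {mpoly rat[k]})) tofrac_eq0.
by rewrite -(rmorph_nat (@mpolyC k rat)) mpolyC_eq0.
Qed.

Lemma tofracX_inj : injective x.
Proof.
move=> i j /eqP; rewrite tofrac_eq => /eqP /(congr1 (mcoeff U_(i))).
rewrite !mcoeffX eqxx; case: eqP => [/(congr1 (fun u : 'X_{1..k} => u i))|_ /eqP].
  by rewrite !mnm1E eqxx; case: eqP => [->|].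
by rewrite oner_eq0.
Qed.

Lemma tofracX_neq0 j : x j != 0.
Proof. by rewrite tofrac_eq0 -msupp_eq0 msuppX. Qed.

Lemma f_root j : laurent_root k h (- x j) /\ laurent_root k h (- (x j)^-1).
Proof.
pose e a := tofrac (mesym k rat a).
have hE z : \sum_(i < k + k.+1) tofrac (f k `|i%:Z - k%:Z|%N) * z ^+ i
    = (\sum_(a < k.+1) e a * z ^+ a) * (\sum_(b < k.+1) e b * z ^+ (k - b)).
  rewrite -sum_f => [|a lt_ka]; last by rewrite /e mesym_geqnE ?tofrac0.
  apply: eq_bigr => i _; congr (_ * _); rewrite fE rmorph_sum.
  by apply: eq_bigr => a _; rewrite rmorphM.
have A0 : \sum_(a < k.+1) e a * (- (x j)^-1) ^+ a = 0.
  rewrite sum_mesym (bigD1 j) //= mulrN divff ?tofracX_neq0 //.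
  by rewrite subrr mul0r.
rewrite /laurent_root !hE A0 mul0r; split=> //.
(* At -x_j it is the second factor that vanishes: reversing its exponents gives the first factor at
   -1/x_j. *)
rewrite [X in _ * X](_ : _ = (- x j) ^+ k * \sum_(a < k.+1) e a * (- (x j)^-1) ^+ a).
  by rewrite A0 !mulr0.
rewrite big_distrr; apply: eq_bigr => a _ /=; rewrite mulrCA; congr (_ * _).
rewrite -invrN exprVn expfB_cond // oppr_eq0 (negPf (tofracX_neq0 j)) add0n.
by rewrite -ltnS ltn_ord.
Qed.

(** The common form of the three identities, for d = 1, 2, 0. After multiplication by the nonzero
    Vandermonde denominator both sides are the determinant of [det_rectangular]. *)
Lemma schur_sum_frobenius m d (sg : seq nat -> K) : (0 < m)%N -> (d <= 2)%N ->
  (forall a, sorted gtn a -> sg (frobenius (2 * m + d - 1) a)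
     = (-1) ^+ sumn a * ((-1) ^+ d * case_sign K d) ^+ size a) ->
  \sum_(l \in frobenius_shift (2 * m + d - 1)) sg l * schur k l
  = (\prod_j diagonal_factor d (x j)
     * \prod_(i < k) \prod_(j < k | (i < j)%N) (1 - x i * x j))
    * (weight K d 0 * \det (\matrix_(s < m, t < m) toeplitz_hankel h d (case_sign K d) s t)).
Proof.
move=> m_gt0 le_d2 sgE; rewrite sum_frobenius_shift.
have alt0 : tofrac (alternant k [::]) = \det (\matrix_(i < k, j < k) x j ^+ (k - i.+1)).
  rewrite -det_map_mx; congr (\det _); apply/matrixP => i j.
  by rewrite !mxE rmorphXn /part nth_nil.
have h_gt j : (k < j)%N -> h j = 0.
  by move=> lt_kj; rewrite /f (eqP (_ : k.+1 - j == 0)%N) ?big_ord0 ?tofrac0 // subn_eq0.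
have h_top : h k = \prod_j x j.
  by rewrite /f /= subSnn big_ord1 mesym0E mul1r addn0 mesymnnE rmorph_prod.
rewrite alt0; set V := \det _; set rhs := (X in _ = X).
have V_neq0 : V != 0 := staircase_neq0 tofracX_neq0 tofracX_inj.
suff -> : \sum_(a <- decreasing_seqs k) sg (frobenius (2 * m + d - 1) a)
    * tofrac (alternant k (frobenius (2 * m + d - 1) a)) = rhs * V by rewrite mulfK.
rewrite /rhs /V -(det_rectangular tofracX_neq0 two_neq0_fraction h_gt h_top f_root m_gt0 le_d2).
pose eta : {mpoly rat[k]} := (-1) ^+ d * (if d is 2 then -1 else 1).
have eta_frac : tofrac eta = (-1) ^+ d * case_sign K d.
  by rewrite rmorphM rmorphXn rmorphN1 /case_sign; case: (d) => [|[|[|?]]];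
    rewrite ?rmorph1 ?rmorphN1.
transitivity (tofrac (\sum_(a <- decreasing_seqs k) (-1) ^+ sumn a * eta ^+ size a *
      alternant k (frobenius (2 * m + d - 1) a))).
  rewrite rmorph_sum; apply: eq_big_seq => a; rewrite mem_decreasing_seqs => /andP[sa _].
  by rewrite sgE // !rmorphM !rmorphXn rmorphN1 /= eta_frac.
rewrite -det_expand_alternant -det_map_mx; congr (\det _); apply/matrixP => i j.
by rewrite !mxE rmorphD rmorphM !rmorphXn /= eta_frac.
Qed.

End Main.

(* Matrix indices are 0-based: the row and column called s, t on paper are
   s.+1, t.+1 here. *)
Theorem theorem6p2 (k m : nat) (hm : (0 < m)%N) :
  [/\ \sum_(l \in frobenius_shift (2 * m))
        (-1) ^+ ((sumn l + rk l) %/ 2 + m * rk l) * schur k l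
      = tofrac
          ((\prod_(i < k) (1 - 'X_i))
           * (\prod_(i < k) \prod_(j < k | (i < j)%N) (1 - 'X_i * 'X_j))
           * \det (\matrix_(s < m, t < m)
               (f k (s.+1%:Z - t.+1%:Z) + f k (s.+1%:Z + t.+1%:Z - 1))))
    , \sum_(l \in frobenius_shift (2 * m + 1))
        (-1) ^+ (sumn l %/ 2 + m * rk l) * schur k l
      = tofrac
          ((\prod_(i < k) \prod_(j < k | (i <= j)%N) (1 - 'X_i * 'X_j))
           * \det (\matrix_(s < m, t < m)
               (f k (s.+1%:Z - t.+1%:Z) - f k (s.+1%:Z + t.+1%:Z))))
    & \sum_(l \in frobenius_shift (2 * m - 1))
        (-1) ^+ (sumn l %/ 2 + m * rk l) * schur k l
      = tofrac
          ((2%:R^-1 : rat) *: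
           ((\prod_(i < k) \prod_(j < k | (i < j)%N) (1 - 'X_i * 'X_j))
            * \det (\matrix_(s < m, t < m)
                (f k (s.+1%:Z - t.+1%:Z) + f k (s.+1%:Z + t.+1%:Z - 2)))))].
Proof.
have sumnE c a : sorted gtn a ->
    sumn (frobenius c a) = (sumn a).*2 + c.+1 * size a /\ rk (frobenius c a) = size a.
  by move=> sa; rewrite sumn_frobenius ?rk_frobenius.
have detE d (M : 'M[{mpoly rat[k]}]_m) :
    (forall s t, tofrac (M s t) = toeplitz_hankel (fun j => tofrac (f k j%:Z)) d
      (case_sign {fraction {mpoly rat[k]}} d) s t) ->
    \det (\matrix_(s < m, t < m) toeplitz_hankel (fun j => tofrac (f k j%:Z)) d
      (case_sign {fraction {mpoly rat[k]}} d) s t) = tofrac (\det M).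
  move=> ME; rewrite -det_map_mx; congr (\det _); apply/matrixP => s t.
  by rewrite !mxE; exact/esym/ME.
have f_abs (i : int) n : `|i|%N = n -> f k i = f k n%:Z by rewrite /f => ->.
have prodE : \prod_(i < k) \prod_(j < k | (i < j)%N) (1 - tofrac 'X_i * tofrac 'X_j)
    = tofrac (\prod_(i < k) \prod_(j < k | (i < j)%N) (1 - 'X_i * 'X_j : {mpoly rat[k]})).
  rewrite rmorph_prod; apply: eq_bigr => i _; rewrite rmorph_prod; apply: eq_bigr => j _.
  by rewrite rmorphB rmorph1 rmorphM.
split.
- have := @schur_sum_frobenius k m 1
    (fun l => (-1) ^+ ((sumn l + rk l) %/ 2 + m * rk l)) hm isT.
  rewrite addnK => ->; last first.
    move=> a sa; have [-> ->] := sumnE (2 * m)%N _ sa; rewrite mulr1 -exprM mul1n.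
    rewrite -exprD -signr_odd.
    rewrite -[RHS]signr_odd; congr (_ ^+ _).
    (* The shape has size 2 [sumn a] + (2m + 1) [size a], so the full exponent is [sumn a] + (2m +
       1) [size a], matching eta = -1. *)
    rewrite [X in (X %/ 2)%N](_ : _ = (sumn a + m.+1 * size a) * 2)%N ?mulnK //; last by lia.
    by rewrite !oddD !oddM /=; case: (odd m); case: (odd (size a)); case: (odd (sumn a)).
  rewrite prodE mul1r (detE _ (\matrix_(s < m, t < m)
    (f k (s.+1%:Z - t.+1%:Z) + f k (s.+1%:Z + t.+1%:Z - 1)))) => [|s t].
    rewrite !rmorphM /=; congr (_ * _ * _); rewrite rmorph_prod; apply: eq_bigr => i _.
    by rewrite rmorphB rmorph1.
  rewrite mxE rmorphD /toeplitz_hankel /= mul1r.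
  (* With indices from 0 the Hankel index is s + t + 1, and [f] depends only on the absolute value,
     so s - t may replace t - s. *)
  by congr (tofrac _ + tofrac _); apply: f_abs; lia.
- have := @schur_sum_frobenius k m 2
    (fun l => (-1) ^+ (sumn l %/ 2 + m * rk l)) hm isT.
  rewrite -addnBA // subn1 => ->; last first.
    move=> a sa; have [-> ->] := sumnE (2 * m + 1)%N _ sa.
    rewrite /= sqrrN expr1n mul1r -exprD -signr_odd.
    rewrite -[RHS]signr_odd; congr (_ ^+ _).
    rewrite [X in (X %/ 2)%N](_ : _ = (sumn a + m.+1 * size a) * 2)%N ?mulnK //; last by lia.
    by rewrite !oddD !oddM /=; case: (odd m); case: (odd (size a)); case: (odd (sumn a)).
  rewrite prodE mul1r (detE _ (\matrix_(s < m, t < m)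
    (f k (s.+1%:Z - t.+1%:Z) - f k (s.+1%:Z + t.+1%:Z)))) => [|s t].
    rewrite (_ : \prod_j _ = tofrac (\prod_(j < k) (1 - 'X_j * 'X_j))); last first.
      rewrite rmorph_prod; apply: eq_bigr => j _ /=.
      by rewrite rmorphB rmorph1 rmorphM expr2.
    (* The factors 1 - x_i^2 are the terms i = j of the product over i <= j. *)
    rewrite -!rmorphM -big_split; congr (tofrac (_ * _)); apply: eq_bigr => i _.
    rewrite [RHS](bigD1 i) //=; congr (_ * _); apply: eq_bigl => j.
    by rewrite ltn_neqAle andbC eq_sym.
  rewrite mxE rmorphB /toeplitz_hankel /= mulN1r.
  by congr (tofrac _ - tofrac _); apply: f_abs; lia.
have := @schur_sum_frobenius k m 0
  (fun l => (-1) ^+ (sumn l %/ 2 + m * rk l)) hm isT.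
rewrite addn0 => ->; last first.
  move=> a sa; have [-> ->] := sumnE (2 * m - 1)%N _ sa.
  rewrite /= mul1r expr1n mulr1 -signr_odd -[RHS]signr_odd; congr (_ ^+ _).
  (* Here the rank contributes m [size a] twice, so only [sumn a] survives modulo 2, matching eta =
     1. *)
  rewrite [X in (X %/ 2)%N](_ : _ = (sumn a + m * size a) * 2)%N ?mulnK //; last by lia.
  by rewrite !oddD !oddM /=; case: (odd m); case: (odd (size a)); case: (odd (sumn a)).
rewrite big1 // mul1r prodE (detE _ (\matrix_(s < m, t < m)
    (f k (s.+1%:Z - t.+1%:Z) + f k (s.+1%:Z + t.+1%:Z - 2)))) => [|s t].
  rewrite -mul_mpolyC !rmorphM /= mulrCA; congr (_ * _); rewrite /weight /=.
  (* The weight 1/2 of the fraction field is the image of the rational 1/2 under the composite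
     embedding. *)
  pose g : {rmorphism rat -> {fraction {mpoly rat[k]}}} := @tofrac _ \o @mpolyC k rat.
  by rewrite -[RHS]/(g _) fmorphV rmorph_nat.
rewrite mxE rmorphD /toeplitz_hankel /= mul1r.
by congr (tofrac _ + tofrac _); apply: f_abs; lia.
Qed.
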